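(* Consider the convex optimisation problem of minimising $f(z)$ over $z\in C$ subject to $g(z)\preceq 0$, where $C\subseteq\mathbb{R}^n$ is convex, $f,g^{(j)}:\mathbb{R}^n\to\mathbb{R}$, $j=1,\dots,m$, are convex, $g=[g^{(1)},\dots,g^{(m)}]^T$, the problem is feasible, and $f^\star$ is its optimal value. Let $\lambda_1\in\mathbb{R}^m_+$, $\alpha>0$, and $$\lambda_{k+1}=[\lambda_k+\alpha g(z_k)]^+,\qquad k=1,2,\dots$$ Suppose the Slater condition is satisfied (there exists $\bar z\in C$ with $g(\bar z)\prec 0$) and that there are $\mu_k\in\mathbb{R}^m_+$, $\epsilon\ge 0$ and $\sigma_0\ge 0$ such that for all $k=1,2,\dots$: (i) $z_k\in C_\epsilon(\mu_k):=\{z\in C: L(z,\mu_k)-q(\mu_k)\le\epsilon\}$; (ii) $\|\lambda_k-\mu_k\|_\infty\le\alpha\sigma_0$. Then there is a positive constant $\bar\lambda$ that does not depend on $k$ such that for all $k=1,2,\dots$ $$-\frac{2m\bar\lambda^2}{\alpha k}-\alpha m\big(\bar g^2/2+\sigma_0(1+\bar g)\big)-\epsilon\ \le\ f(z_k^\diamond)-f^\star\ \le\ \epsilon+\alpha m\big(\bar g^2+\sigma_0(1+\bar g)\big)+\frac{3m\bar\lambda^2}{2\alpha k},$$ where $z_k^\diamond:=\frac1k\sum_{i=1}^k z_i$ and $\bar g:=\max_{z\in C}\|g(z)\|_\infty$.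
   Context: The Lagrangian is $L(z,\lambda):=f(z)+\lambda^Tg(z)$ for $\lambda\in\mathbb{R}^m_+$, and the dual function is $q(\lambda):=\min_{z\in C}L(z,\lambda)$ for $\lambda\succeq 0$. $[\cdot]^+$ is the elementwise positive part; $\preceq,\prec,\succeq$ are elementwise. The set of optima is non-empty, with $f^\star=f(z^\star)$ for an optimal $z^\star$. The minima defining $q$ and the maximum defining $\bar g$ are assumed to exist and be finite (as is the case when $C$ is closed and bounded). *)

(* Defs.v *)
From HB Require Import structures.
From mathcomp Require Import all_boot all_order all_algebra.
From mathcomp Require Import all_classical all_reals all_analysis.

Set Implicit Arguments.
Unset Strict Implicit.
Unset Printing Implicit Defensive.

Import Order.TTheory GRing.Theory Num.Theory.
Import numFieldNormedType.Exports.

Local Open Scope classical_set_scope.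
Local Open Scope ring_scope.

Definition has_minimum (R : realType) (A : set R) : Prop :=
  exists2 v, A v & lbound A v.

Definition has_maximum (R : realType) (A : set R) : Prop :=
  exists2 v, A v & ubound A v.

Definition vle (R : realType) (m : nat) (u v : 'cV[R]_m) : Prop :=
  forall j, u j 0 <= v j 0.

Definition vlt (R : realType) (m : nat) (u v : 'cV[R]_m) : Prop :=
  forall j, u j 0 < v j 0.

Definition pos_part (R : realType) (m : nat) (u : 'cV[R]_m) : 'cV[R]_m :=
  map_mx (fun x => Num.max x 0) u.

Definition lagrangian (R : realType) (n m : nat) (f : 'cV[R]_n -> R)
    (g : 'cV[R]_n -> 'cV[R]_m) (z : 'cV[R]_n) (lam : 'cV[R]_m) : R :=
  f z + (lam^T *m g z) 0 0.

(* The infimum is the minimum whenever the image satisfies [has_minimum];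
   likewise for [optimal_value] below and for [sup] in [constraint_bound]. *)
Definition dual (R : realType) (n m : nat) (C : set 'cV[R]_n)
    (f : 'cV[R]_n -> R) (g : 'cV[R]_n -> 'cV[R]_m) (lam : 'cV[R]_m) : R :=
  inf [set lagrangian f g z lam | z in C].

Definition eps_minimizers (R : realType) (n m : nat) (C : set 'cV[R]_n)
    (f : 'cV[R]_n -> R) (g : 'cV[R]_n -> 'cV[R]_m) (eps : R)
    (mu : 'cV[R]_m) : set 'cV[R]_n :=
  [set z | C z /\ lagrangian f g z mu - dual C f g mu <= eps].

Definition feasible (R : realType) (n m : nat) (C : set 'cV[R]_n)
    (g : 'cV[R]_n -> 'cV[R]_m) : set 'cV[R]_n :=
  [set z | C z /\ vle (g z) 0].

Definition optima (R : realType) (n m : nat) (C : set 'cV[R]_n)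
    (f : 'cV[R]_n -> R) (g : 'cV[R]_n -> 'cV[R]_m) : set 'cV[R]_n :=
  [set z | feasible C g z /\ forall y, feasible C g y -> f z <= f y].

Definition optimal_value (R : realType) (n m : nat) (C : set 'cV[R]_n)
    (f : 'cV[R]_n -> R) (g : 'cV[R]_n -> 'cV[R]_m) : R :=
  inf [set f z | z in feasible C g].

(* The norm of the library on matrices is the largest absolute value of an
   entry, that is, the infinity norm on column vectors. *)
Definition constraint_bound (R : realType) (n m : nat) (C : set 'cV[R]_n)
    (g : 'cV[R]_n -> 'cV[R]_m) : R :=
  sup [set `|g z| | z in C].

Definition running_average (R : realType) (n : nat) (z : nat -> 'cV[R]_n)
    (k : nat) : 'cV[R]_n :=
  k%:R^-1 *: \sum_(1 <= i < k.+1) z i.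

(* Main.v *)
(* Upper bound: q(mu_i) <= f* and the near-minimality of z_i bound f(z_i) - f*
   by eps - mu_i^T g(z_i); replacing mu_i by lambda_i costs alpha m sigma0 gbar,
   and the drift of |lambda_i|^2 makes the sum of the - lambda_i^T g(z_i)
   telescope.  Lower bound, without strong duality: the drift, together with the
   Slater point zbar, keeps lambda_k bounded; as lambda_(k+1) dominates
   alpha (g(z_1) + ... + g(z_k)), the average violates the constraints by
   O(1/k), so mixing it with a weight O(1/k) of zbar gives a feasible point,
   whose value is at least f*. *)
Require Import Defs.
From HB Require Import structures.
From mathcomp Require Import all_boot all_order all_algebra.
From mathcomp Require Import all_classical all_reals all_analysis.
From mathcomp Require Import ring lra.
Import Order.TTheory GRing.Theory Num.Theory.
Import numFieldNormedType.Exports.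
Local Open Scope classical_set_scope.
Local Open Scope ring_scope.

(** * Inner products and the max norm *)

Local Notation dot u v := ((u^T *m v) 0 0).

Lemma dotE (R : realType) (m : nat) (u v : 'cV[R]_m) :
  dot u v = \sum_j u j 0 * v j 0.
Proof. by rewrite mxE; apply: eq_bigr => j _; rewrite mxE. Qed.

Lemma ler_coord_norm (R : realType) (m : nat) (u : 'cV[R]_m) (j : 'I_m) :
  `|u j 0| <= `|u|.
Proof.
rewrite [leRHS]mx_normrE.
exact: (le_bigmax _ (fun ij : 'I_m * 'I_1 => `|u ij.1 ij.2|) (j, 0)).
Qed.

Lemma dot_le0 (R : realType) (m : nat) (u v : 'cV[R]_m) :
  vle 0 u -> vle v 0 -> dot u v <= 0.
Proof.
move=> u0 v0; rewrite dotE; apply: sumr_le0 => j _.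
by have := u0 j; have := v0 j; rewrite !mxE => ? ?; rewrite mulr_ge0_le0.
Qed.

Lemma ler_dot_norm (R : realType) (m : nat) (u v : 'cV[R]_m) :
  dot u v <= m%:R * (`|u| * `|v|).
Proof.
rewrite dotE mulr_natl -[X in _ *+ X]card_ord -sumr_const ler_sum// => j _.
rewrite (le_trans (ler_norm _))// normrM.
by rewrite ler_pM// ler_coord_norm.
Qed.

Lemma sum_le_norm (R : realType) (m : nat) (u : 'cV[R]_m) :
  \sum_j u j 0 <= m%:R * `|u|.
Proof.
rewrite mulr_natl -[X in _ *+ X]card_ord -sumr_const ler_sum// => j _.
by rewrite (le_trans (ler_norm _))// ler_coord_norm.
Qed.

(** Expanding the square only adds cross products of nonnegative entries. It turns a bound on the
    sum of multipliers into one on their squared norm. *)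
Lemma dot_le_sqr_sum (R : realType) (m : nat) (u : 'cV[R]_m) :
  vle 0 u -> dot u u <= (\sum_j u j 0) ^+ 2.
Proof.
move=> u0; have {}u0 j : 0 <= u j 0 by have := u0 j; rewrite mxE.
rewrite dotE expr2 mulr_suml ler_sum// => j _.
by rewrite ler_wpM2l// (bigD1 j)//= lerDl sumr_ge0.
Qed.

(** From [x <= 1 + x ^+ 2], which recovers a bound on entries from the squared norm without a square
    root. *)
Lemma coord_le_dot (R : realType) (m : nat) (u : 'cV[R]_m) (j : 'I_m) :
  u j 0 <= 1 + dot u u.
Proof.
rewrite dotE (bigD1 j)//=.
have : 0 <= \sum_(i < m | i != j) u i 0 * u i 0.
  by apply: sumr_ge0 => i _; rewrite -expr2 sqr_ge0.
set s := \sum_(_ < _ | _) _ => s0; set x := u j 0.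
by have := sqr_ge0 (x - 1); nra.
Qed.

(** Truncation at 0 never increases the square of an entry. This is the one-step drift inequality of
    the multiplier recursion. *)
Lemma dot_pos_part (R : realType) (m : nat) (u v : 'cV[R]_m) (a : R) :
  dot (pos_part (u + a *: v)) (pos_part (u + a *: v)) <=
  dot u u + 2 * a * dot u v + a ^+ 2 * dot v v.
Proof.
rewrite !dotE !mulr_sumr -!big_split/=; apply: ler_sum => j _.
rewrite !mxE; set x := u j 0; set y := v j 0.
have -> : x * x + 2 * a * (x * y) + a ^+ 2 * (y * y) = (x + a * y) ^+ 2 by ring.
rewrite -expr2; case: (leP (x + a * y) 0) => // h.
by rewrite expr0n/= sqr_ge0.
Qed.

(** * Convexity and running averages *)

Lemma conv_mem (R : realType) (n : nat) (C : set 'cV[R]_n) (p : R)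
    (x y : 'cV[R]_n) : convex_set C -> 0 <= p -> p <= 1 -> C x -> C y ->
  C (p *: x + (1 - p) *: y).
Proof.
move=> cC p0 p1 Cx Cy.
by have := cC x y (Itv01 p0 p1) (mem_set Cx) (mem_set Cy) => /set_mem.
Qed.

Lemma convex_function_le (R : realType) (n : nat) (f : 'cV[R]_n -> R) (p : R)
    (x y : 'cV[R]_n) : convex_function setT f -> 0 <= p -> p <= 1 ->
  f (p *: x + (1 - p) *: y) <= p * f x + (1 - p) * f y.
Proof.
by move=> cf p0 p1; have := cf (Itv01 p0 p1) x y (in_setT _) (in_setT _).
Qed.

Lemma running_average1 (R : realType) (n : nat) (z : nat -> 'cV[R]_n) :
  running_average z 1 = z 1%N.
Proof. by rewrite /running_average big_nat1 invr1 scale1r. Qed.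

(** Each average is a two-point convex combination of the previous one and the new term, so
    two-point convexity suffices for Jensen by induction. *)
Lemma running_averageS (R : realType) (n k : nat) (z : nat -> 'cV[R]_n) :
  (1 <= k)%N ->
  running_average z k.+1 = (k%:R / k.+1%:R) *: running_average z k
                           + (1 - k%:R / k.+1%:R) *: z k.+1.
Proof.
move=> k1; rewrite /running_average big_nat_recr//= scalerDr scalerA.
have k0 : k%:R != 0 :> R by rewrite pnatr_eq0 -lt0n.
have kS0 : k.+1%:R != 0 :> R by rewrite pnatr_eq0.
congr (_ *: _ + _ *: _); first by field; rewrite nat1r kS0 k0.
by rewrite -(@natr1 _ k) in kS0 *; field.
Qed.

Lemma divS_itv01 (R : realType) (k : nat) :
  0 <= k%:R / k.+1%:R :> R /\ k%:R / k.+1%:R <= 1 :> R.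
Proof.
split; first by rewrite divr_ge0.
by rewrite ler_pdivrMr ?ltr0n// mul1r ler_nat.
Qed.

Lemma running_average_mem (R : realType) (n : nat) (C : set 'cV[R]_n)
    (z : nat -> 'cV[R]_n) : convex_set C ->
  (forall k, (1 <= k)%N -> C (z k)) ->
  forall k, (1 <= k)%N -> C (running_average z k).
Proof.
move=> cC Cz; elim=> [//|[_ _|k IH _]].
  by rewrite running_average1; exact: Cz.
have [p0 p1] := divS_itv01 R k.+1.
by rewrite running_averageS//; apply: conv_mem => //; [exact: IH|exact: Cz].
Qed.

Lemma convex_running_average (R : realType) (n : nat) (f : 'cV[R]_n -> R)
    (z : nat -> 'cV[R]_n) : convex_function setT f ->
  forall k, (1 <= k)%N ->
    k%:R * f (running_average z k) <= \sum_(1 <= i < k.+1) f (z i).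
Proof.
move=> cf; elim=> [//|[_ _|k IH _]].
  by rewrite running_average1 big_nat1 mul1r.
have [p0 p1] := divS_itv01 R k.+1.
rewrite running_averageS// big_nat_recr//=.
have := convex_function_le _ _ _ _ (running_average z k.+1) (z k.+2) cf p0 p1.
rewrite -(ler_pM2l (ltr0Sn R k.+1)) => /le_trans; apply.
rewrite mulrDr !mulrA mulrBr mulr1 mulrCA divff ?pnatr_eq0// mulr1.
rewrite lerD//; first by rewrite [_ / _]mulrAC divff ?pnatr_eq0// mul1r IH.
by rewrite -[k.+2%:R]natr1 addrAC subrr add0r mul1r.
Qed.

(** * Weak duality and the constraint bound *)

Lemma dual_le (R : realType) (n m : nat) (C : set 'cV[R]_n)
    (f : 'cV[R]_n -> R) (g : 'cV[R]_n -> 'cV[R]_m) (lam : 'cV[R]_m)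
    (z : 'cV[R]_n) :
  has_minimum [set lagrangian f g z lam | z in C] -> C z ->
  dual C f g lam <= lagrangian f g z lam.
Proof. by move=> [v _ lbv] Cz; apply: ge_inf; [exists v|exists z]. Qed.

Lemma optimal_value_le (R : realType) (n m : nat) (C : set 'cV[R]_n)
    (f : 'cV[R]_n -> R) (g : 'cV[R]_n -> 'cV[R]_m) (y : 'cV[R]_n) :
  optima C f g !=set0 -> feasible C g y -> optimal_value C f g <= f y.
Proof.
move=> [x [Fx minx]] Fy; apply: ge_inf; last by exists y.
by exists (f x) => _ [w Fw <-]; exact: minx.
Qed.

Lemma dual_le_optimal_value (R : realType) (n m : nat) (C : set 'cV[R]_n)
    (f : 'cV[R]_n -> R) (g : 'cV[R]_n -> 'cV[R]_m) (lam : 'cV[R]_m) :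
  has_minimum [set lagrangian f g z lam | z in C] ->
  feasible C g !=set0 -> vle 0 lam ->
  dual C f g lam <= optimal_value C f g.
Proof.
move=> hm [x Fx] lam0; apply: lb_le_inf; first by exists (f x), x.
move=> _ [y [Cy gy] <-]; apply: le_trans (dual_le _ _ _ _ _ _ _ _ hm Cy) _.
by rewrite /lagrangian gerDl; exact: dot_le0.
Qed.

Lemma norm_le_constraint_bound (R : realType) (n m : nat) (C : set 'cV[R]_n)
    (g : 'cV[R]_n -> 'cV[R]_m) (z : 'cV[R]_n) :
  has_maximum [set `|g z| | z in C] -> C z -> `|g z| <= constraint_bound C g.
Proof. by move=> [v _ ubv] Cz; apply: ub_le_sup; [exists v|exists z]. Qed.

(** * The Slater point: margin, feasible mixtures, drift *)

Lemma vlt0_margin (R : realType) (m : nat) (v : 'cV[R]_m) :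
  vlt v 0 -> exists2 eta, 0 < eta & forall j, v j 0 <= - eta.
Proof.
(* The default value 1 keeps the margin positive when [m = 0]. *)
move=> v0; exists (\big[Num.min/1]_j (- v j 0)).
  by apply/bigmin_gtP; split => // j _; have := v0 j; rewrite mxE oppr_gt0.
by move=> j; rewrite lerNr; exact: bigmin_le_cond.
Qed.

(* The mixture of z and zbar in proportion 1 : t is feasible. *)
Lemma slater_mix (R : realType) (n m : nat) (C : set 'cV[R]_n)
    (f : 'cV[R]_n -> R) (g : 'cV[R]_n -> 'cV[R]_m) (z zbar : 'cV[R]_n)
    (eta t : R) :
  convex_set C -> convex_function setT f ->
  (forall j : 'I_m, convex_function setT (fun z => g z j 0)) ->
  optima C f g !=set0 -> C z -> C zbar ->
  (forall j, g zbar j 0 <= - eta) -> 0 <= t ->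
  (forall j, g z j 0 <= t * eta) ->
  - (t * (f zbar - optimal_value C f g)) <= f z - optimal_value C f g.
Proof.
move=> cC cf cg opt Cz Czb gzb t0 gz.
have t1 : 0 < 1 + t by lra.
set p := (1 + t)^-1.
have p0 : 0 <= p by rewrite invr_ge0 ltW.
have p1 : p <= 1 by rewrite invf_le1//; lra.
have pE : 1 - p = p * t by rewrite /p; field; rewrite gt_eqF.
have mix a b : p * a + (1 - p) * b = p * (a + t * b).
  by rewrite pE; ring.
have Fw : feasible C g (p *: z + (1 - p) *: zbar).
  split; first exact: conv_mem.
  move=> j; apply: le_trans (convex_function_le _ _ _ _ z zbar (cg j) p0 p1) _.
  rewrite mix mxE mulr_ge0_le0//.
  have := gz j; have := ler_wpM2l t0 (gzb j); lra.
have := le_trans (optimal_value_le _ _ _ _ _ _ _ opt Fw)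
  (convex_function_le _ _ _ _ z zbar cf p0 p1).
(* Clearing the factor [p] leaves [(1 + t) * fstar <= f z + t * f zbar], with [fstar] the optimal
   value. *)
rewrite mix mulrC ler_pdivlMr//; lra.
Qed.

Lemma seq_le_max (R : realType) (V : nat -> R) (M : R) :
  (forall k, (1 <= k)%N -> V k.+1 <= V k \/ V k.+1 <= M) ->
  forall k, (1 <= k)%N -> V k <= Num.max (V 1%N) M.
Proof.
move=> step; elim=> [//|[_ _|k IH _]]; first by rewrite le_max lexx.
have [//|h|h] := step k.+1; first exact: le_trans h (IH isT).
by rewrite le_max h orbT.
Qed.

(* The Lagrangian at z nearly minimises, so it is compared with its value at
   zbar; f z is bounded below by the dual function at 0. *)
Lemma slater_drift (R : realType) (n m : nat) (C : set 'cV[R]_n)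
    (f : 'cV[R]_n -> R) (g : 'cV[R]_n -> 'cV[R]_m) (eps eta : R)
    (mu : 'cV[R]_m) (z zbar : 'cV[R]_n) :
  (forall lam : 'cV[R]_m, vle 0 lam ->
     has_minimum [set lagrangian f g z lam | z in C]) ->
  vle 0 mu -> C zbar -> (forall j, g zbar j 0 <= - eta) ->
  eps_minimizers C f g eps mu z ->
  dot mu (g z) <= eps + f zbar - dual C f g 0 - eta * \sum_j mu j 0.
Proof.
move=> hm mu0 Czb gzb [Cz zeps].
have h0 : dual C f g 0 <= f z.
  apply: le_trans (dual_le _ _ _ _ _ _ _ _ (hm 0 _) Cz) _.
    by move=> j; rewrite mxE.
  by rewrite /lagrangian trmx0 mul0mx mxE addr0.
have := dual_le _ _ _ _ _ _ _ _ (hm mu mu0) Czb.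
move: zeps; rewrite /lagrangian.
have : dot mu (g zbar) <= - (eta * \sum_j mu j 0).
  rewrite dotE mulr_sumr -sumrN; apply: ler_sum => j _.
  by rewrite mulrC -mulNr ler_wpM2r//; have := mu0 j; rewrite mxE.
lra.
Qed.

Lemma dot_norm_le (R : realType) (m : nat) (u : 'cV[R]_m) (G : R) :
  `|u| <= G -> dot u u <= m%:R * G ^+ 2.
Proof.
move=> uG; apply: le_trans (ler_dot_norm _ _ _ _) _.
by rewrite expr2 ler_wpM2l// ler_pM.
Qed.

(** * The multiplier recursion *)

Lemma multiplier_ge0 (R : realType) (m : nat) (alpha : R)
    (lambda w : nat -> 'cV[R]_m) :
  vle 0 (lambda 1%N) ->
  (forall k, (1 <= k)%N -> lambda k.+1 = pos_part (lambda k + alpha *: w k)) ->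
  forall k, (1 <= k)%N -> vle 0 (lambda k).
Proof.
move=> l1 lS [//|[//|k]] _; rewrite lS// => j.
by rewrite !mxE le_max lexx orbT.
Qed.

(** Truncation at 0 only increases an entry, so the recursion dominates the untruncated sum; the
    initial multiplier is dropped by its sign. A bound on multipliers thus controls cumulated
    constraint violation. *)
Lemma sum_le_multiplier (R : realType) (m : nat) (alpha : R)
    (lambda w : nat -> 'cV[R]_m) (j : 'I_m) :
  vle 0 (lambda 1%N) ->
  (forall k, (1 <= k)%N -> lambda k.+1 = pos_part (lambda k + alpha *: w k)) ->
  forall k, alpha * (\sum_(1 <= i < k.+1) w i j 0) <= lambda k.+1 j 0.
Proof.
move=> l1 lS; elim=> [|k IH].
  by rewrite big_geq// mulr0; have := l1 j; rewrite mxE.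
rewrite big_nat_recr//= mulrDr lS// !mxE le_max.
by apply/orP; left; rewrite lerD2r.
Qed.

Lemma sum_dot_multiplier (R : realType) (m : nat) (alpha G : R)
    (lambda w : nat -> 'cV[R]_m) :
  (forall k, (1 <= k)%N -> lambda k.+1 = pos_part (lambda k + alpha *: w k)) ->
  (forall k, (1 <= k)%N -> `|w k| <= G) ->
  forall k, - (2 * alpha * \sum_(1 <= i < k.+1) dot (lambda i) (w i)) <=
    dot (lambda 1%N) (lambda 1%N) - dot (lambda k.+1) (lambda k.+1)
    + k%:R * (alpha ^+ 2 * (m%:R * G ^+ 2)).
Proof.
move=> lS wG; elim=> [|k IH].
  by rewrite big_geq// mulr0 oppr0 subrr mul0r addr0.
rewrite big_nat_recr//= -[k.+1%:R]natr1.
have := dot_pos_part _ _ (lambda k.+1) (w k.+1) alpha; rewrite -lS//.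
have := ler_wpM2l (sqr_ge0 alpha) (dot_norm_le _ _ _ _ (wG k.+1 isT)).
lra.
Qed.

(** Lyapunov argument on the squared norm: when the entries sum to at least a threshold [B], the
    negative drift outweighs the quadratic term and the norm does not grow; otherwise the squared
    norm is at most [B ^+ 2] and one step stays below a fixed [M]. *)
Lemma multiplier_bounded (R : realType) (m : nat) (alpha eta D G : R)
    (lambda w : nat -> 'cV[R]_m) :
  0 < alpha -> 0 < eta ->
  vle 0 (lambda 1%N) ->
  (forall k, (1 <= k)%N -> lambda k.+1 = pos_part (lambda k + alpha *: w k)) ->
  (forall k, (1 <= k)%N -> `|w k| <= G) ->
  (forall k, (1 <= k)%N ->
     dot (lambda k) (w k) <= D - eta * \sum_j lambda k j 0) ->
  exists2 Lam, 0 <= Lam &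
    forall k, (1 <= k)%N -> forall j, lambda k j 0 <= Lam.
Proof.
move=> a0 e0 l1 lS wG drift.
have l0 := multiplier_ge0 _ _ _ _ _ l1 lS.
pose N := alpha ^+ 2 * (m%:R * G ^+ 2).
(* [B] is the value of [s] at which [2 * alpha * (D - eta * s) + N] vanishes; [M] bounds a step
   taken from squared norm at most [B ^+ 2], with the [eta] term dropped. *)
pose B := (D + N / (2 * alpha)) / eta.
pose M := B ^+ 2 + 2 * alpha * D + N.
pose V k := dot (lambda k) (lambda k).
have V0 k : 0 <= V k.
  by rewrite /V dotE sumr_ge0// => j _; rewrite -expr2 sqr_ge0.
have VS k : (1 <= k)%N -> V k.+1 <= V k \/ V k.+1 <= M.
  move=> k1; set s := \sum_j lambda k j 0.
  have s0 : 0 <= s.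
    by apply: sumr_ge0 => j _; have := l0 k k1 j; rewrite mxE.
  have step : V k.+1 <= V k + 2 * alpha * (D - eta * s) + N.
    rewrite /V lS//; apply: le_trans (dot_pos_part _ _ _ _ _) _.
    rewrite -!addrA lerD2l; apply: lerD.
      by rewrite ler_wpM2l ?drift// mulr_ge0// ltW.
    by rewrite ler_wpM2l ?sqr_ge0// dot_norm_le// wG.
  have [Bs|sB] := leP B s.
    left; apply: le_trans step _.
    have : D + N / (2 * alpha) <= eta * s.
      by rewrite [eta * s]mulrC -ler_pdivrMr.
    have a2 : 0 < 2 * alpha by rewrite mulr_gt0.
    move/(ler_wpM2l (ltW a2)).
    rewrite mulrDr [_ * (N / _)]mulrCA divff ?gt_eqF//.
    lra.
  right; apply: le_trans step _.
  have : V k <= B ^+ 2.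
    apply: le_trans (dot_le_sqr_sum _ _ _ (l0 k k1)) _.
    by rewrite ler_sqr ?nnegrE//; [exact: ltW|exact: le_trans s0 (ltW sB)].
  have : 0 <= 2 * alpha * (eta * s) by rewrite !mulr_ge0// ltW.
  rewrite /M; lra.
have Vb := seq_le_max _ _ _ VS.
exists (1 + Num.max (V 1%N) M); first by rewrite addr_ge0// le_max V0.
move=> k k1 j; apply: le_trans (coord_le_dot _ _ _ j) _.
by rewrite lerD2l Vb.
Qed.

(** * Replacing [mu] by [lambda], and the two bounds *)

Lemma dot_perturb (R : realType) (m : nat) (u v w : 'cV[R]_m) (d G : R) :
  `|u - v| <= d -> `|w| <= G -> `|dot u w - dot v w| <= m%:R * (d * G).
Proof.
move=> uv wG.
have -> : dot u w - dot v w = dot (u - v) w.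
  by rewrite [(u - v)^T]linearB/= mulmxBl !mxE.
have le_dG (x : 'cV[R]_m) : `|x| <= d -> dot x w <= m%:R * (d * G).
  move=> xd; apply: le_trans (ler_dot_norm _ _ _ _) _.
  by rewrite ler_wpM2l// ler_pM.
rewrite ler_norml le_dG// andbT lerNl.
have -> : - dot (u - v) w = dot (- (u - v)) w.
  by rewrite [(- (u - v))^T]linearN/= mulNmx [in RHS]mxE.
by rewrite le_dG// normrN.
Qed.

Theorem theorem3 (R : realType) (n m : nat) (C : set 'cV[R]_n)
  (f : 'cV[R]_n -> R) (g : 'cV[R]_n -> 'cV[R]_m)
  (C_convex : convex_set C)
  (f_convex : convex_function setT f)
  (g_convex : forall j : 'I_m, convex_function setT (fun z => g z j 0))
  (feasible_neq0 : feasible C g !=set0)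
  (optima_neq0 : optima C f g !=set0)
  (dual_min : forall lam : 'cV[R]_m, vle 0 lam ->
     has_minimum [set lagrangian f g z lam | z in C])
  (gbar_max : has_maximum [set `|g z| | z in C])
  (alpha eps sigma0 : R) (lambda mu : nat -> 'cV[R]_m) (z : nat -> 'cV[R]_n)
  (lambda1_ge0 : vle 0 (lambda 1%N))
  (alpha_gt0 : 0 < alpha)
  (lambdaS : forall k, (1 <= k)%N ->
     lambda k.+1 = pos_part (lambda k + alpha *: g (z k)))
  (slater : exists2 zbar, C zbar & vlt (g zbar) 0)
  (mu_ge0 : forall k, (1 <= k)%N -> vle 0 (mu k))
  (eps_ge0 : 0 <= eps)
  (sigma0_ge0 : 0 <= sigma0)
  (z_eps : forall k, (1 <= k)%N -> eps_minimizers C f g eps (mu k) (z k))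
  (lambda_mu : forall k, (1 <= k)%N -> `|lambda k - mu k| <= alpha * sigma0) :
  let fstar := optimal_value C f g in
  let gbar := constraint_bound C g in
  exists2 lambdabar : R, 0 < lambdabar &
    forall k, (1 <= k)%N ->
      - (2 * m%:R * lambdabar ^+ 2 / (alpha * k%:R))
        - alpha * m%:R * (gbar ^+ 2 / 2 + sigma0 * (1 + gbar)) - eps
        <= f (running_average z k) - fstar
      /\ f (running_average z k) - fstar
        <= eps + alpha * m%:R * (gbar ^+ 2 + sigma0 * (1 + gbar))
           + 3 * m%:R * lambdabar ^+ 2 / (2 * alpha * k%:R).
Proof.
move=> fstar gbar.
have [zbar Czb /vlt0_margin[eta eta0 gzb]] := slater.
have Cz k : (1 <= k)%N -> C (z k) by move=> /z_eps[].
have gz k : (1 <= k)%N -> `|g (z k)| <= gbar.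
  by move=> /Cz; exact: norm_le_constraint_bound.
have gbar0 : 0 <= gbar by apply: le_trans (gz 1%N isT); exact: normr_ge0.
have lw k : (1 <= k)%N ->
    `|dot (lambda k) (g (z k)) - dot (mu k) (g (z k))|
      <= m%:R * (alpha * sigma0 * gbar).
  by move=> k1; apply: dot_perturb; [exact: lambda_mu|exact: gz].
(* The last two terms pay for passing from [mu k] to [lambda k], first in the inner product and then
   in the sum of entries. *)
pose D := eps + f zbar - dual C f g 0 + m%:R * (alpha * sigma0 * gbar)
          + eta * (m%:R * (alpha * sigma0)).
have drift k : (1 <= k)%N ->
    dot (lambda k) (g (z k)) <= D - eta * \sum_j lambda k j 0.
  move=> k1.
  have := slater_drift _ _ _ _ _ _ _ _ _ _ _ dual_min (mu_ge0 _ k1) Czb gzb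
    (z_eps _ k1).
  have := ler_normlW (lw k k1).
  have : \sum_j lambda k j 0 - \sum_j mu k j 0 <= m%:R * (alpha * sigma0).
    rewrite -sumrB; apply: le_trans (_ : _ <= m%:R * `|lambda k - mu k|) _.
      apply: le_trans (sum_le_norm _ _ _).
      by apply: ler_sum => j _; rewrite !mxE.
    by rewrite ler_wpM2l// lambda_mu.
  move/(ler_wpM2l (ltW eta0)); rewrite /D; lra.
have [Lam Lam0 lamLam] := multiplier_bounded _ _ _ _ _ _ _ _ alpha_gt0 eta0
  lambda1_ge0 lambdaS gz drift.
have K0 : 0 <= f zbar - fstar.
  rewrite subr_ge0; apply: optimal_value_le => //; split=> // j.
  by rewrite mxE; apply: le_trans (gzb j) _; rewrite oppr_le0 ltW.
pose c := Lam * (f zbar - fstar) / eta.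
have c0 : 0 <= c by rewrite /c divr_ge0// ?mulr_ge0// ltW.
(* One constant serves both bounds: [1 <= lb] and [c <= lb] give [c <= lb ^+ 2] for the lower one,
   and the norm of [lambda 1] is at most [lb] for the upper one. *)
exists (1 + `|lambda 1%N| + c).
  by have := normr_ge0 (lambda 1%N); lra.
set lb := 1 + _ + _.
have lb1 : 1 <= lb by rewrite /lb; have := normr_ge0 (lambda 1%N); lra.
move=> k k1.
have k0 : 0 < k%:R :> R by rewrite ltr0n.
have ak0 : 0 < alpha * k%:R by rewrite mulr_gt0.
split.
  (* The average violates each constraint by at most [Lam / (alpha * k%:R)], so weight [t] of [zbar]
     compensates. The factor [m%:R] is harmless since an index [j] forces [1 <= m], and it makes [t]
     vanish for [m = 0], as the claimed bound does. *)
  pose t := m%:R * (Lam / (alpha * k%:R * eta)).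
  have t0 : 0 <= t by rewrite !mulr_ge0// invr_ge0 ltW// mulr_gt0.
  have Czd : C (running_average z k) by exact: running_average_mem.
  have gzd j : g (running_average z k) j 0 <= t * eta.
    have m1 : 1 <= m%:R :> R by rewrite ler1n (leq_ltn_trans _ (ltn_ord j)).
    have := convex_running_average _ _ _ z (g_convex j) k k1.
    rewrite -(ler_pM2l alpha_gt0) => /le_trans.
    move=> /(_ _ (sum_le_multiplier _ _ _ _ (g \o z) j lambda1_ge0 lambdaS k)).
    move=> /le_trans /(_ (lamLam k.+1 isT j)).
    rewrite mulrA mulrC -ler_pdivlMr// => /le_trans; apply.
    have -> : t * eta = m%:R * (Lam / (alpha * k%:R)).
      by rewrite /t; field; rewrite !gt_eqF.
    by rewrite ler_peMl// divr_ge0// ltW.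
  have := slater_mix _ _ _ _ f g _ _ _ _ C_convex f_convex g_convex optima_neq0
    Czd Czb gzb t0 gzd; rewrite -/fstar.
  apply: le_trans.
  have -> : t * (f zbar - fstar) = m%:R * c / (alpha * k%:R).
    by rewrite /t /c; field; rewrite !gt_eqF.
  have cl : m%:R * c / (alpha * k%:R)
      <= 2 * m%:R * lb ^+ 2 / (alpha * k%:R).
    apply: ler_wpM2r; first by rewrite invr_ge0 ltW.
    rewrite [leRHS]mulrAC [leRHS]mulrC ler_wpM2l//.
    have : c <= lb by rewrite /lb; have := normr_ge0 (lambda 1%N); lra.
    nra.
  (* The [alpha] and [eps] terms of the lower bound are pure slack: the [O(1/k)] term already
     suffices. *)
  have : 0 <= alpha * m%:R * (gbar ^+ 2 / 2 + sigma0 * (1 + gbar)).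
    have a0 := ltW alpha_gt0.
    by rewrite !(mulr_ge0, addr_ge0, invr_ge0, sqr_ge0).
  lra.
have fz i : (1 <= i)%N -> f (z i) <= fstar + eps
    + m%:R * (alpha * sigma0 * gbar) - dot (lambda i) (g (z i)).
  move=> i1; have [_] := z_eps i i1; rewrite /lagrangian.
  have := dual_le_optimal_value _ _ _ _ f _ _ (dual_min _ (mu_ge0 _ i1))
    feasible_neq0 (mu_ge0 _ i1).
  rewrite -/fstar; have := ler_normlW (lw i i1); lra.
have S1 := convex_running_average _ _ _ z f_convex k k1.
have S2 : \sum_(1 <= i < k.+1) f (z i) <= k%:R * (fstar + eps
    + m%:R * (alpha * sigma0 * gbar))
    - \sum_(1 <= i < k.+1) dot (lambda i) (g (z i)).
  (* [k] is read as [k.+1 - 1], the number of indices, to make the constant part a sum. *)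
  rewrite mulr_natl -[X in _ *+ X](subn1 k.+1) -sumr_const_nat -sumrB.
  by rewrite ler_sum_nat// => i /andP[i1 _]; exact: fz.
have S3 := sum_dot_multiplier _ _ _ _ _ (g \o z) lambdaS gz k.
have S4 : dot (lambda 1%N) (lambda 1%N) <= m%:R * lb ^+ 2.
  by apply: dot_norm_le; rewrite /lb; lra.
have S5 : 0 <= dot (lambda k.+1) (lambda k.+1).
  by rewrite dotE sumr_ge0// => j _; rewrite -expr2 sqr_ge0.
set s := \sum_(1 <= i < k.+1) dot (lambda i) _ in S2 S3.
(* [P1] and [P2] are exactly the slack between the stated upper bound and the one derived, which has
   [gbar ^+ 2 / 2], [sigma0 * gbar] and the factor 1/2 in place of 3/2. *)
have P1 : 0 <= alpha * m%:R * (gbar ^+ 2 / 2 + sigma0).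
  have a0 := ltW alpha_gt0.
  by rewrite !(mulr_ge0, addr_ge0, invr_ge0, sqr_ge0).
have P2 : 0 <= m%:R * lb ^+ 2 / (alpha * k%:R).
  by apply: divr_ge0; [rewrite mulr_ge0 ?sqr_ge0|exact: ltW].
(* The telescoped drift [S3] divided by [2 * alpha * k%:R], with the final squared norm discarded by
   [S5]. *)
have S6 : - s / k%:R <= m%:R * lb ^+ 2 / (2 * (alpha * k%:R))
    + alpha * m%:R * gbar ^+ 2 / 2.
  rewrite ler_pdivrMr// -(ler_pM2l (mulr_gt0 (ltr0n R 2) alpha_gt0)).
  have -> : 2 * alpha * ((m%:R * lb ^+ 2 / (2 * (alpha * k%:R))
      + alpha * m%:R * gbar ^+ 2 / 2) * k%:R)
    = m%:R * lb ^+ 2 + k%:R * (alpha ^+ 2 * (m%:R * gbar ^+ 2)).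
    by field; rewrite !gt_eqF.
  lra.
have S7 : f (running_average z k) <=
    fstar + eps + m%:R * (alpha * sigma0 * gbar) - s / k%:R.
  rewrite -(ler_pM2l k0) mulrBr [_ * (s / _)]mulrCA divff ?gt_eqF// mulr1.
  exact: le_trans S1 S2.
(* Both fractions are written through the one in [P2], so that the conclusion becomes linear. *)
have E1 : m%:R * lb ^+ 2 / (2 * (alpha * k%:R))
    = m%:R * lb ^+ 2 / (alpha * k%:R) / 2 by field; rewrite !gt_eqF.
have E2 : 3 * m%:R * lb ^+ 2 / (2 * alpha * k%:R)
    = 3 / 2 * (m%:R * lb ^+ 2 / (alpha * k%:R)) by field; rewrite !gt_eqF.
rewrite E2; rewrite E1 in S6; lra.
Qed.
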